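(* Fix $\beta \in \mathbb{R}_{>0}$ and $0<x,y<1$. For each integer $N>\beta$ let $\omega^{(N)}$ be a random permutation of $\{1,\dots,N\}$ distributed according to the Mallows measure $\mathcal{M}_{N}^{q}$ with $q=1-\beta/N$, all $\omega^{(N)}$ being defined on a common probability space. Then $$\frac{H_{\lfloor x N\rfloor, \lfloor y N\rfloor}(\omega^{(N)})}{N}\longrightarrow h_{\beta}(x,y)\qquad \text{almost surely as } N\to\infty.$$
   Context: For $q\in[0,1)$, the Mallows measure $\mathcal{M}_N^q$ on permutations of $\{1,\dots,N\}$ assigns to a permutation $w$ the probability $q^{\mathrm{inv}(w)}Y_N$, where $\mathrm{inv}(w)$ is the number of inversions of $w$ and $Y_N=\prod_{j=1}^N\frac{1-q}{1-q^j}$. The height function of a permutation $\omega$ of size $N$ is $H_{L,K}(\omega) := \#\{ i : 1 \le i \le L,\ 1 \le \omega(i) \le K \}$, for integers $1\le L,K\le N$. For $\beta>0$, $x,y\in(0,1)$: $$h_{\beta}(x, y)=\frac{1}{\beta}\left[\ln(1-e^{-\beta})-\ln(e^{-\beta x}+e^{-\beta y}-e^{-\beta(x+y)}-e^{-\beta})\right].$$ *)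

(* Defs.v *)
From HB Require Import structures.
From mathcomp Require Import all_boot all_order all_algebra all_fingroup.
From mathcomp Require Import all_classical all_reals all_analysis.
Set Implicit Arguments.
Unset Strict Implicit.
Unset Printing Implicit Defensive.
Import Order.TTheory GRing.Theory Num.Theory.
Import numFieldNormedType.Exports.
Local Open Scope classical_set_scope.
Local Open Scope ring_scope.

Definition inversions (N : nat) (w : 'S_N) : nat :=
  #|[set p : 'I_N * 'I_N | (p.1 < p.2)%N && (w p.2 < w p.1)%N]%SET|.

Definition mallows_weight (R : realType) (N : nat) (q : R) (w : 'S_N) : R :=
  q ^+ inversions w * \prod_(1 <= j < N.+1) ((1 - q) / (1 - q ^+ j)).

(* A random permutation is a map all of whose events are measurable, i.e. a
   measurable map into the finite set 'S_N with its discrete sigma-algebra. *)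
Definition mallows_distributed (R : realType) (d : measure_display)
    (T : measurableType d) (P : probability T R) (N : nat) (q : R)
    (X : T -> 'S_N) : Prop :=
  forall A : {set 'S_N},
    measurable [set t | X t \in A] /\
    P [set t | X t \in A] = (\sum_(w in A) mallows_weight q w)%:E.

(* Indices are 0-based: the positions 1..L are the i : 'I_N with i < L, and
   the values 1..K are those < K. *)
Definition height (N : nat) (w : 'S_N) (L K : nat) : nat :=
  #|[set i : 'I_N | (i < L)%N && (w i < K)%N]%SET|.

Definition height_limit (R : realType) (beta x y : R) : R :=
  beta^-1 * (ln (1 - expR (- beta)) -
    ln (expR (- beta * x) + expR (- beta * y)
        - expR (- beta * (x + y)) - expR (- beta))).

(* Main.v *)
Require Import Defs.
From HB Require Import structures.
From mathcomp Require Import all_boot all_order all_algebra all_fingroup.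
From mathcomp Require Import all_classical all_reals all_analysis.
From mathcomp Require Import ring lra zify.
Set Implicit Arguments.
Unset Strict Implicit.
Unset Printing Implicit Defensive.
Import Order.TTheory GRing.Theory Num.Theory.
Import numFieldNormedType.Exports.
Local Open Scope classical_set_scope.
Local Open Scope ring_scope.

(** The idea is to look at the variable q ^ H, where H is the height, rather
than at H itself: its mean is explicit and it concentrates.

Reading a Mallows permutation of N.+1 letters from the left, the first value is
v (counted from 0) with probability proportional to q ^ v, and the remaining
letters, once standardised, form an independent Mallows permutation of N
letters (mallows_meanS). If v < K, which has probability
(1 - q ^ K) / (1 - q ^ N.+1), the height at (L.+1, K) is one plus the height of
the standardised rest at (L, K.-1); otherwise it is the height of the rest at
(L, K). Under this recursion

  m(N, L, K) = q ^ K + (1 - q ^ K) (q ^ L - q ^ N) / (1 - q ^ N)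

behaves as the mean of q ^ H: revealing the first value changes the
conditional mean by a centred amount of size at most 1 - q
(height_mean_step_lt and height_mean_step_ge). An Azuma-type induction on N
therefore bounds the exponential moment
E exp (l (q ^ H - m)) by exp (2 N (l (1 - q)) ^ 2) when |l| (1 - q) <= 1/2
(height_mgf_le), and Chernoff's inequality gives a tail bound (height_tail).

For q = 1 - beta / N and l = delta N, this bound is
2 exp (- delta (eps - 2 delta beta ^ 2) N), which is geometric in N when delta
is small. No independence between different N is then needed: by the
Borel-Cantelli lemma, q ^ H - m converges to 0 almost surely. Since
q ^ (floor (c N)) converges to exp (- beta c), the means m converge to

  (exp (- beta x) + exp (- beta y) - exp (- beta (x + y)) - exp (- beta))
    / (1 - exp (- beta)),

which is exp (- beta h) for h the claimed limit. Taking logarithms and using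
N ln (1 - beta / N) --> - beta turns q ^ H --> exp (- beta h) into
H / N --> h. *)

(** * Inserting a first letter in a permutation *)

Lemma inversionsE (N : nat) (w : 'S_N) :
  inversions w = (\sum_(i < N) \sum_(j < N) ((i < j) && (w j < w i)))%N.
Proof.
by rewrite pair_big /= /inversions -sum1dep_card big_mkcond.
Qed.

Lemma heightE (N : nat) (w : 'S_N) (L K : nat) :
  height w L K = (\sum_(i < N) ((i < L) && (w i < K)))%N.
Proof. by rewrite /height -sum1dep_card big_mkcond. Qed.

Lemma sum_ltn_perm (N : nat) (s : 'S_N) (v : nat) :
  (v <= N)%N -> (\sum_(j < N) (s j < v))%N = v.
Proof.
move=> vN; transitivity (\sum_(j < N) (j < v))%N.
  by rewrite [RHS](reindex_perm s).
rewrite -(big_mkord xpredT (fun j => (j < v)%N : nat)).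
rewrite (@big_cat_nat _ _ _ v) //=.
rewrite (eq_big_nat _ _ (F2 := fun=> 1%N)) => [|i /andP[_ ->]//].
rewrite sum_nat_const_nat subn0 muln1 big_nat_cond big1 ?addn0 //.
move=> i /andP[/andP[vi _] _].
by rewrite ltnNge vi.
Qed.

(** The first letter v is inverted with the v smaller values, all of which come
later. *)
Lemma inversions_lift (N : nat) (v : 'I_N.+1) (s : 'S_N) :
  inversions (lift_perm ord0 v s) = (v + inversions s)%N.
Proof.
rewrite !inversionsE big_ord_recl lift_perm_id; congr (_ + _)%N.
  rewrite big_ord_recl /= add0n -[RHS](@sum_ltn_perm _ s v) -1?ltnS //.
  apply: eq_bigr => j _; rewrite lift_perm_lift /= /bump.
  by congr nat_of_bool; lia.
apply: eq_bigr => i _; rewrite big_ord_recl /= add0n.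
apply: eq_bigr => j _; rewrite !lift_perm_lift /= /bump.
by congr nat_of_bool; lia.
Qed.

Lemma height_lift_lt (N : nat) (v : 'I_N.+1) (s : 'S_N) (L K : nat) :
  (v <= K)%N -> height (lift_perm ord0 v s) L.+1 K.+1 = (height s L K).+1.
Proof.
move=> vK; rewrite !heightE big_ord_recl lift_perm_id /= ltnS vK add1n.
congr _.+1; apply: eq_bigr => i _; rewrite lift_perm_lift /= /bump.
by congr nat_of_bool; lia.
Qed.

Lemma height_lift_ge (N : nat) (v : 'I_N.+1) (s : 'S_N) (L K : nat) :
  (K <= v)%N -> height (lift_perm ord0 v s) L.+1 K = height s L K.
Proof.
move=> Kv; rewrite !heightE big_ord_recl lift_perm_id /= ltnNge Kv add0n.
apply: eq_bigr => i _; rewrite lift_perm_lift /= /bump.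
by congr nat_of_bool; lia.
Qed.

(** A permutation is determined by its first value and by the standardisation
of the remaining ones. *)
Lemma lift_perm_bij (N : nat) :
  bijective (fun p : 'I_N.+1 * 'S_N => lift_perm ord0 p.1 p.2).
Proof.
apply: inj_card_bij; last by rewrite card_prod !card_Sn card_ord factS.
move=> [v s] [v' s'] /= e.
have ev : v = v' by rewrite -(lift_perm_id ord0 v s) e lift_perm_id.
subst v'; suff ->: s = s' by [].
apply/permP => i; apply: (@lift_inj _ v).
by rewrite -2!(lift_perm_lift ord0) e.
Qed.

(** * Expectations under the Mallows measure *)

(** The expectation of f under the Mallows measure, as a finite sum. *)
Definition mallows_mean (R : realType) (N : nat) (q : R) (f : 'S_N -> R) : R :=
  \sum_w mallows_weight q w * f w.

Section mallows.
Variables (R : realType) (q : R).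
Hypotheses (q_gt0 : 0 < q) (q_lt1 : q < 1).

Let subX_gt0 (n : nat) : 0 < 1 - q ^+ n.+1.
Proof. by rewrite subr_gt0 exprn_ilt1 // ltW. Qed.

Let subX_neq0 (n : nat) : 1 - q ^+ n.+1 != 0.
Proof. by rewrite gt_eqF. Qed.

Lemma mallows_weight_ge0 (N : nat) (w : 'S_N) : 0 <= mallows_weight q w.
Proof.
rewrite mulr_ge0 ?exprn_ge0 ?(ltW q_gt0) // big_nat_cond.
rewrite prodr_ge0 // => -[|j] //= _.
by rewrite divr_ge0 // ltW // subr_gt0.
Qed.

Lemma mallows_weight_lift (N : nat) (v : 'I_N.+1) (s : 'S_N) :
  mallows_weight q (lift_perm ord0 v s) =
  q ^+ v * ((1 - q) / (1 - q ^+ N.+1)) * mallows_weight q s.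
Proof.
rewrite /mallows_weight inversions_lift exprD big_nat_recr //=; ring.
Qed.

(** The law of the first value and, given it, of the remaining ones. *)
Lemma mallows_meanS (N : nat) (f : 'S_N.+1 -> R) :
  mallows_mean q f =
  \sum_(v < N.+1) q ^+ v * ((1 - q) / (1 - q ^+ N.+1)) *
                  mallows_mean q (fun s => f (lift_perm ord0 v s)).
Proof.
rewrite /mallows_mean (reindex _ (onW_bij _ (lift_perm_bij N))) /=.
rewrite -(pair_bigA _ (fun v s => mallows_weight q (lift_perm ord0 v s) *
                                  f (lift_perm ord0 v s))) /=.
apply: eq_bigr => v _; rewrite mulr_sumr; apply: eq_bigr => s _.
by rewrite mallows_weight_lift mulrA.
Qed.

Lemma sum_expr_ord (n : nat) :
  \sum_(v < n) q ^+ v * (1 - q) = 1 - q ^+ n.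
Proof. by rewrite -mulr_suml mulrC -opprB mulNr -subrX1 opprB. Qed.

(** Conditioning only on whether the first value is below K; the first fraction
is the probability of that event. *)
Lemma mallows_mean_first (N K : nat) (f : 'S_N.+1 -> R) (a b : R) :
  (K <= N.+1)%N ->
  (forall v : 'I_N.+1, (v < K)%N ->
     mallows_mean q (fun s => f (lift_perm ord0 v s)) <= a) ->
  (forall v : 'I_N.+1, (K <= v)%N ->
     mallows_mean q (fun s => f (lift_perm ord0 v s)) <= b) ->
  mallows_mean q f <=
  (1 - q ^+ K) / (1 - q ^+ N.+1) * a +
  (1 - (1 - q ^+ K) / (1 - q ^+ N.+1)) * b.
Proof.
move=> KN fa fb; rewrite mallows_meanS.
set c := (1 - q) / (1 - q ^+ N.+1).
have c0 : 0 <= c by rewrite divr_ge0 // ltW // subr_gt0.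
apply: (@le_trans _ _
  (\sum_(v < N.+1) q ^+ v * c * (if (v < K)%N then a else b))).
  apply: ler_sum => v _; apply: ler_wpM2l.
    by rewrite mulr_ge0 // exprn_ge0 ?(ltW q_gt0).
  by case: ltnP => vK; [apply: fa|apply: fb].
have -> : \sum_(v < N.+1) q ^+ v * c * (if (v < K)%N then a else b) =
    (\sum_(v < N.+1 | (v < K)%N) q ^+ v * (1 - q)) / (1 - q ^+ N.+1) * (a - b)
    + (\sum_(v < N.+1) q ^+ v * (1 - q)) / (1 - q ^+ N.+1) * b.
  rewrite [in X in X / _ * (a - b)]big_mkcond !mulr_suml -big_split /=.
  by apply: eq_bigr => v _; rewrite /c; case: ifP => _; ring.
have -> : \sum_(v < N.+1 | (v < K)%N) q ^+ v * (1 - q) = 1 - q ^+ K.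
  by rewrite -(big_ord_widen _ (fun v => q ^+ v * (1 - q))) // sum_expr_ord.
rewrite sum_expr_ord divff // le_eqVlt; apply/orP; left; apply/eqP; ring.
Qed.

Lemma mallows_mean_cst (N : nat) (a : R) :
  mallows_mean q (fun _ : 'S_N => a) = a.
Proof.
elim: N => [|N IHN].
  rewrite /mallows_mean (eq_bigl (pred1 1%g)) ?big_pred1_eq; last first.
    by move=> w /=; apply/esym/eqP/permP => -[].
  rewrite /mallows_weight inversionsE big_ord0 big_nil.
  by rewrite expr0 !mul1r.
rewrite mallows_meanS; under eq_bigr => v _ do rewrite IHN mulrA.
by rewrite -2!mulr_suml sum_expr_ord divff // mul1r.
Qed.

Lemma mallows_meanZ (N : nat) (a : R) (f : 'S_N -> R) :
  mallows_mean q (fun w => f w * a) = mallows_mean q f * a.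
Proof.
by rewrite /mallows_mean mulr_suml; apply: eq_bigr => w _; rewrite mulrA.
Qed.

(** * Concentration of the height *)

(** The factor by which reading the first L letters multiplies q ^ (H - K) - 1
on average. It is 0 when N = 0, because of the convention 0^-1 = 0. *)
Definition read_ratio (N L : nat) : R := (q ^+ L - q ^+ N) / (1 - q ^+ N).

(** The mean of q ^ H for H the height at (L, K) of a Mallows permutation of N
letters, when L <= N and K <= N. *)
Definition height_mean (N L K : nat) : R :=
  q ^+ K + (1 - q ^+ K) * read_ratio N L.

Lemma read_ratioM (N L : nat) : (L <= N)%N ->
  read_ratio N L * (1 - q ^+ N) = q ^+ L - q ^+ N.
Proof.
case: N => [|N] LN; last by rewrite /read_ratio divfK.
by move: LN; rewrite leqn0 => /eqP ->; rewrite expr0 subrr mulr0.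
Qed.

Lemma read_ratio_ge0 (N L : nat) : (L <= N)%N -> 0 <= read_ratio N L.
Proof.
move=> LN; rewrite divr_ge0 // subr_ge0.
  by rewrite ler_wiXn2l // ltW.
by rewrite exprn_ile1 // ltW.
Qed.

Lemma read_ratio_le1 (N L : nat) : (L <= N)%N -> read_ratio N L <= 1.
Proof.
case: N => [|N] LN; first by rewrite /read_ratio expr0 subrr invr0 mulr0.
by rewrite ler_pdivrMr // mul1r lerB // exprn_ile1 // ltW.
Qed.

(** The change of the conditional mean when the first value is below K.+1. *)
Lemma height_mean_step_lt (N L K : nat) : (L <= N)%N ->
  q * height_mean N L K - height_mean N.+1 L.+1 K.+1 =
  - (1 - (1 - q ^+ K.+1) / (1 - q ^+ N.+1)) * (1 - q) * read_ratio N L.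
Proof.
move=> /read_ratioM rE; rewrite /height_mean.
have -> : read_ratio N.+1 L.+1 =
          q * (read_ratio N L * (1 - q ^+ N)) / (1 - q ^+ N.+1).
  by rewrite rE mulrBr -!exprS.
by have := subX_neq0 N; rewrite !exprS => nz; field.
Qed.

(** The change of the conditional mean when the first value is at least K. *)
Lemma height_mean_step_ge (N L K : nat) : (L <= N)%N ->
  height_mean N L K - height_mean N.+1 L.+1 K =
  (1 - q ^+ K) / (1 - q ^+ N.+1) * (1 - q) * read_ratio N L.
Proof.
move=> /read_ratioM rE; rewrite /height_mean.
have -> : read_ratio N.+1 L.+1 =
          q * (read_ratio N L * (1 - q ^+ N)) / (1 - q ^+ N.+1).
  by rewrite rE mulrBr -!exprS.
by have := subX_neq0 N; rewrite !exprS => nz; field.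
Qed.

Lemma expR_le_quadratic (t : R) : t <= 2^-1 -> expR t <= 1 + t + 2 * t ^+ 2.
Proof.
move=> t2; have t1 : 0 < 1 - t by lra.
apply: (@le_trans _ _ (1 - t)^-1).
  rewrite -[expR t]invrK lef_pV2 ?posrE ?invr_gt0 ?expR_gt0 //.
  by rewrite -expRN; exact: expR_ge1Dx.
rewrite -[_^-1]mul1r ler_pdivrMr //.
have : 0 <= t ^+ 2 * (1 - 2 * t) by rewrite mulr_ge0 ?sqr_ge0 //; lra.
nra.
Qed.

(** Exponential moment of a centred two-point law bounded by s. *)
Lemma two_point_mgf (p u v s : R) : 0 <= p <= 1 -> `|u| <= s -> `|v| <= s ->
  s <= 2^-1 -> p * u + (1 - p) * v = 0 ->
  p * expR u + (1 - p) * expR v <= expR (2 * s ^+ 2).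
Proof.
move=> /andP[p0 p1] us vs s2 uv.
have sq_le z : `|z| <= s -> z ^+ 2 <= s ^+ 2.
  move=> zs; rewrite -real_normK ?num_real // lerXn2r // ?nnegrE //.
  exact: le_trans zs.
have u2 := sq_le _ us; have v2 := sq_le _ vs.
have eu := expR_le_quadratic (le_trans (ler_norm _) (le_trans us s2)).
have ev := expR_le_quadratic (le_trans (ler_norm _) (le_trans vs s2)).
apply: (le_trans _ (expR_ge1Dx _)).
have p1' : 0 <= 1 - p by lra.
apply: (le_trans (lerD (ler_wpM2l p0 eu) (ler_wpM2l p1' ev))).
have := lerD (ler_wpM2l p0 u2) (ler_wpM2l p1' v2).
lra.
Qed.

(** Both branches of the recursion are bounded by the same induction hypothesis
(in the branch where the height increases, l becomes l * q), so that only a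
centred two-point law of size 1 - q remains at each step. *)
Lemma height_mgf_le (N L K : nat) (l : R) : (L <= N)%N -> (K <= N)%N ->
  `|l| * (1 - q) <= 2^-1 ->
  mallows_mean q (fun w : 'S_N =>
    expR (l * (q ^+ height w L K - height_mean N L K))) <=
  expR (N%:R * (2 * (l * (1 - q)) ^+ 2)).
Proof.
(* If L or K is 0, the height is 0 and q ^ H and its mean are 1. *)
have degenerate M L' K' l' : (L' <= M)%N -> (K' <= M)%N ->
  (L' == 0) || (K' == 0)%N ->
  mallows_mean q (fun w : 'S_M =>
    expR (l' * (q ^+ height w L' K' - height_mean M L' K'))) <=
  expR (M%:R * (2 * (l' * (1 - q)) ^+ 2)).
  move=> L'M K'M z.
  have m1 : height_mean M L' K' = 1.
    rewrite /height_mean /read_ratio.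
    case/orP: z => /eqP z0; subst; rewrite !expr0 ?subrr ?mul0r ?addr0 //.
    case: M K'M {L'M} => [|M] K'M; last by rewrite divff // mulr1 addrC subrK.
    by move: K'M; rewrite leqn0 => /eqP ->; rewrite expr0 subrr mul0r addr0.
  have h0 (w : 'S_M) : height w L' K' = 0%N.
    by rewrite heightE big1 // => i _; case/orP: z => /eqP ->; rewrite ?andbF.
  rewrite [X in X <= _](_ : _ = mallows_mean q (fun _ : 'S_M => 1)); last first.
    by apply: eq_bigr => w _; rewrite h0 m1 expr0 subrr mulr0 expR0.
  rewrite mallows_mean_cst -expR0 ler_expR mulr_ge0 //.
  by rewrite mulr_ge0 // sqr_ge0.
elim: N L K l => [|N IHN] [|L] [|K] l LN KN lq; try exact: degenerate.
rewrite !ltnS in LN KN.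
have q1 : 0 <= 1 - q by rewrite subr_ge0 ltW.
set M := height_mean N.+1 L.+1 K.+1.
set B := expR (N%:R * (2 * (l * (1 - q)) ^+ 2)).
set p := (1 - q ^+ K.+1) / (1 - q ^+ N.+1).
have p0 : 0 <= p by rewrite divr_ge0 // ltW.
have p1 : p <= 1.
  by rewrite ler_pdivrMr // mul1r lerB // ler_wiXn2l // ltW.
set d1 := - (1 - p) * (1 - q) * read_ratio N L.
set d2 := p * (1 - q) * read_ratio N L.
have r0 := read_ratio_ge0 LN; have r1 := read_ratio_le1 LN.
have rp := mulr_ge0 q1 r0.
have rq : (1 - q) * read_ratio N L <= 1 - q by rewrite ler_piMr.
apply: le_trans (mallows_mean_first (K := K.+1) (a := B * expR (l * d1))
  (b := B * expR (l * d2)) _ _ _) _ => //.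
- move=> v vK.
  rewrite [X in X <= _](_ : _ = mallows_mean q (fun s : 'S_N =>
      expR (l * q * (q ^+ height s L K - height_mean N L K))) * expR (l * d1)).
    rewrite ler_wpM2r ?expR_ge0 // (le_trans (IHN _ _ _ LN KN _)) //.
      apply: le_trans lq; rewrite normrM ler_wpM2r // ler_piMr // gtr0_norm //.
      exact: ltW.
    rewrite ler_expR ler_wpM2l // ler_wpM2l // mulrAC [leLHS]exprMn.
    rewrite ler_piMr ?sqr_ge0 //.
    by rewrite exprn_ile1 ?ltW.
  rewrite -mallows_meanZ; apply: eq_bigr => s _.
  rewrite height_lift_lt // -expRD; congr (_ * expR _).
  rewrite /d1 -height_mean_step_lt // -/M exprS; ring.
- move=> v vK; have {}KN : (K.+1 <= N)%N by rewrite (leq_trans vK) // -ltnS.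
  rewrite [X in X <= _](_ : _ = mallows_mean q (fun s : 'S_N =>
      expR (l * (q ^+ height s L K.+1 - height_mean N L K.+1)))
      * expR (l * d2)).
    by rewrite ler_wpM2r ?expR_ge0 // IHN.
  rewrite -mallows_meanZ; apply: eq_bigr => s _.
  rewrite height_lift_ge // -expRD; congr (_ * expR _).
  rewrite /d2 -height_mean_step_ge // -/M; ring.
rewrite -/p !(mulrCA _ B) -mulrDr -natr1 [X in _ <= expR X]mulrDl mul1r expRD.
rewrite ler_wpM2l ?expR_ge0 //.
rewrite -(real_normK (num_real (l * _))) normrM (ger0_norm q1).
apply: two_point_mgf => //; first by rewrite p0.
- rewrite normrM ler_wpM2l // /d1 -mulrA normrM normrN (ger0_norm rp).
  rewrite ger0_norm ?subr_ge0 // (le_trans _ rq) // ler_piMl //; lra.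
- rewrite normrM ler_wpM2l // /d2 -mulrA (ger0_norm (mulr_ge0 p0 rp)).
  by rewrite (le_trans _ rq) // ler_piMl.
- rewrite /d1 /d2; ring.
Qed.

(** Chernoff's bound, from the exponential moments at l and - l. *)
Lemma height_tail (N L K : nat) (l eps : R) : (L <= N)%N -> (K <= N)%N ->
  0 <= l -> l * (1 - q) <= 2^-1 ->
  \sum_(w in [set w : 'S_N |
      (eps <= `|q ^+ height w L K - height_mean N L K|)%R]%SET)
    mallows_weight q w <=
  2 * expR (N%:R * (2 * (l * (1 - q)) ^+ 2) - l * eps).
Proof.
move=> LN KN l0 lq.
pose g (l' : R) (w : 'S_N) :=
  expR (l' * (q ^+ height w L K - height_mean N L K)).
apply: (@le_trans _ _ ((mallows_mean q (g l) + mallows_mean q (g (- l))) *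
                        expR (- (l * eps)))).
  rewrite -big_split mulr_suml /= big_mkcond /=; apply: ler_sum => w _.
  have w0 := mallows_weight_ge0 w.
  have g0 l' : 0 <= g l' w by exact: expR_ge0.
  rewrite inE; case: ifPn => [ew|_]; last first.
    by rewrite mulr_ge0 ?expR_ge0 // addr_ge0 // mulr_ge0.
  rewrite -mulrDr -mulrA ler_peMr //.
  rewrite expRN -[leLHS](@divff _ (expR (l * eps))) ?gt_eqF ?expR_gt0 //.
  rewrite ler_wpM2r ?invr_ge0 ?expR_ge0 //.
  move: ew; rewrite ler_normr => /orP[] ew.
    apply: (@le_trans _ _ (g l w)); last by rewrite lerDl.
    by rewrite ler_expR ler_wpM2l.
  apply: (@le_trans _ _ (g (- l) w)); last by rewrite lerDr.
  by rewrite ler_expR mulNr -mulrN ler_wpM2l.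
rewrite expRD mulrA ler_wpM2r ?expR_ge0 // mulr_natl mulr2n lerD //.
  by apply: height_mgf_le => //; rewrite ger0_norm.
rewrite -[X in X ^+ 2]opprK sqrrN -mulNr.
by apply: height_mgf_le => //; rewrite normrN ger0_norm.
Qed.

End mallows.

(** * Almost sure avoidance of events of geometrically small probability *)

Lemma borel_cantelli_geometric (d : measure_display) (T : measurableType d)
    (R : realType) (P : probability T R) (F : (set T)^nat) (C r : R) :
  (forall n, measurable (F n)) -> 0 <= C -> 0 <= r < 1 ->
  (forall n, (P (F n) <= (C * r ^+ n)%:E)%E) ->
  {ae P, forall t, \forall n \near \oo, ~ F n t}.
Proof.
move=> mF C0 /andP[r0 r1] PF.
have lim0 : P (lim_sup_set F) = 0%E.
  apply: lim_sup_set_cvg0 => //.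
  apply: (@le_lt_trans _ _ (\sum_(n <oo) (geometric C r n)%:E)%E).
    by apply: lee_nneseries => // n _; exact: PF.
  have cv : cvgn (series (geometric C r)).
    by apply: is_cvg_geometric_series; rewrite ger0_norm.
  rewrite (_ : (fun n => _) = EFin \o series (geometric C r)).
    by rewrite EFin_lim // ltry.
  by apply/funext => n /=; rewrite sumEFin.
exists (lim_sup_set F); split => //.
  apply: bigcap_measurable => // n _.
  by apply: bigcup_measurable => k _; exact: mF.
move=> t /= nt n _; apply: contrapT => nF; apply: nt.
exists n => // m /= nm Ft; apply: nF; exists m => //.
Qed.

(** * The regime q = 1 - beta / N *)

Section scaling.
Variables (R : realType) (beta : R).
Hypothesis beta_gt0 : 0 < beta.

Let near_gt_beta : \forall N \near \oo, beta < N%:R.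
Proof. exact: nbhs_infty_gtr. Qed.

Lemma parameter_itv (N : nat) : beta < N%:R -> 0 < 1 - beta / N%:R < 1.
Proof.
move=> bN; have N0 := lt_trans beta_gt0 bN.
by rewrite subr_gt0 ltr_pdivrMr // mul1r bN ltrBlDr ltrDl divr_gt0.
Qed.

Lemma cvg_divn (a : R) : a / n%:R @[n --> \oo] --> (0 : R).
Proof.
rewrite -(mulr0 a); apply: cvgMl_tmp; apply/gtr0_cvgV0; last exact: cvgr_idn.
by near=> n; rewrite ltr0n; near: n; exact: nbhs_infty_gt.
Unshelve. all: by end_near. Qed.

(** Both bounds come from ln (1 + t) <= t, applied to 1 - beta / n and to its
inverse. *)
Lemma cvg_nln : n%:R * ln (1 - beta / n%:R) @[n --> \oo] --> - beta.
Proof.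
have cv : - (beta / (1 - beta / n%:R)) @[n --> \oo] --> - beta.
  apply: cvgN; rewrite -[X in _ --> X]divr1; apply: cvgM; first exact: cvg_cst.
  apply: cvgV; first exact: oner_neq0.
  rewrite -[X in _ --> X]subr0; apply: cvgB; [exact: cvg_cst|exact: cvg_divn].
apply: squeeze_cvgr cv (cvg_cst _) => //.
near=> n.
have bn : beta < n%:R by near: n.
have /andP[q0 q1] := parameter_itv bn.
have n0 : 0 < n%:R :> R := lt_trans beta_gt0 bn.
apply/andP; split; last first.
  rewrite mulrC -ler_pdivlMr // mulNr; apply: le_ln1Dx; lra.
rewrite lerNl -mulrN -lnV ?posrE // mulrC -ler_pdivlMr //.
have -> : beta / (1 - beta / n%:R) / n%:R = (1 - beta / n%:R)^-1 - 1.
  by field; rewrite !gt_eqF // subr_gt0.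
have := @le_ln1Dx R ((1 - beta / n%:R)^-1 - 1).
rewrite [X in ln X]addrC subrK; apply.
by rewrite ltrBrDl subrr invr_gt0.
Unshelve. all: by end_near. Qed.

Lemma cvg_parameter_expr (k : nat -> nat) (c : R) :
  (k n)%:R / n%:R @[n --> \oo] --> c ->
  (1 - beta / n%:R) ^+ k n @[n --> \oo] --> expR (- beta * c).
Proof.
move=> kc.
have cv : expR ((k n)%:R / n%:R * (n%:R * ln (1 - beta / n%:R)))
    @[n --> \oo] --> expR (- beta * c).
  apply: continuous_cvg; first exact: continuous_expR.
  by rewrite mulrC; apply: cvgM => //; exact: cvg_nln.
apply: cvg_trans cv; apply: near_eq_cvg; near=> n.
have bn : beta < n%:R by near: n.
have /andP[q0 q1] := parameter_itv bn.
have n0 : 0 < n%:R :> R := lt_trans beta_gt0 bn.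
by rewrite mulrA divfK ?gt_eqF // expRM_natl lnK.
Unshelve. all: by end_near. Qed.

Lemma cvg_truncn_div (x : R) : 0 <= x ->
  (Num.truncn (x * n%:R))%:R / n%:R @[n --> \oo] --> x.
Proof.
move=> x0; have cv : x - 1 / n%:R @[n --> \oo] --> x.
  rewrite -[X in _ --> X]subr0; apply: cvgB; [exact: cvg_cst|exact: cvg_divn].
apply: squeeze_cvgr cv (cvg_cst _); near=> n.
have n0 : 0 < n%:R :> R by rewrite ltr0n; near: n; exact: nbhs_infty_gt.
have /andP[tl tg] := truncn_itv (mulr_ge0 x0 (ltW n0)).
rewrite ler_pdivlMr // ler_pdivrMr // tl andbT mulrBl mul1r mulVf ?gt_eqF //.
by rewrite lerBlDr natr1 ltW.
Unshelve. all: by end_near. Qed.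

(** The limit of the mean of q ^ H. *)
Definition limit_mean (x y : R) : R :=
  expR (- beta * y) + (1 - expR (- beta * y)) *
    ((expR (- beta * x) - expR (- beta)) / (1 - expR (- beta))).

Let one_sub_exp_gt0 : 0 < 1 - expR (- beta).
Proof. by rewrite subr_gt0 expR_lt1 oppr_lt0. Qed.

Lemma cvg_height_mean (x y : R) : 0 <= x -> 0 <= y ->
  height_mean (1 - beta / n%:R) n
    (Num.truncn (x * n%:R)) (Num.truncn (y * n%:R))
    @[n --> \oo] --> limit_mean x y.
Proof.
move=> x0 y0.
have cx := cvg_parameter_expr (cvg_truncn_div x0).
have cy := cvg_parameter_expr (cvg_truncn_div y0).
have c1 : (1 - beta / n%:R) ^+ n @[n --> \oo] --> expR (- beta).
  rewrite -[- beta]mulr1; apply: (@cvg_parameter_expr id).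
  apply: cvg_near_cst; near=> n.
  by rewrite /= divff // pnatr_eq0 -lt0n; near: n; exact: nbhs_infty_gt.
have nz : 1 - expR (- beta) != 0.
  by rewrite gt_eqF.
apply: cvgD => //; apply: cvgM; first by apply: cvgB => //; exact: cvg_cst.
apply: cvgM; first exact: cvgB.
by apply: cvgV => //; apply: cvgB => //; exact: cvg_cst.
Unshelve. all: by end_near. Qed.

Lemma limit_meanE (x y : R) : limit_mean x y =
  (expR (- beta * x) + expR (- beta * y) - expR (- beta * (x + y))
   - expR (- beta)) / (1 - expR (- beta)).
Proof.
rewrite /limit_mean [- beta * (x + y)]mulrDr expRD; field.
by rewrite gt_eqF.
Qed.

Lemma limit_mean_num_gt0 (x y : R) : 0 < x < 1 -> 0 < y < 1 ->
  0 < expR (- beta * x) + expR (- beta * y) - expR (- beta * (x + y))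
      - expR (- beta).
Proof.
move=> /andP[x0 x1] /andP[y0 y1].
have a1 : expR (- beta) < expR (- beta * x).
  by rewrite ltr_expR mulNr ltrN2 gtr_pMr.
have b1 : expR (- beta * x) < 1 by rewrite expR_lt1 mulNr oppr_lt0 mulr_gt0.
have b0 := expR_gt0 (- beta * y).
have := mulr_gt0 b0 (_ : 0 < 1 - expR (- beta * x)).
rewrite subr_gt0 => /(_ b1).
rewrite [- beta * (x + y)]mulrDr expRD; lra.
Qed.

Lemma limit_mean_gt0 (x y : R) : 0 < x < 1 -> 0 < y < 1 -> 0 < limit_mean x y.
Proof.
by move=> x01 y01; rewrite limit_meanE divr_gt0 // limit_mean_num_gt0.
Qed.

Lemma height_limitE (x y : R) : 0 < x < 1 -> 0 < y < 1 ->
  height_limit beta x y = - beta^-1 * ln (limit_mean x y).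
Proof.
move=> x01 y01; rewrite limit_meanE ln_div ?posrE ?limit_mean_num_gt0 //.
by rewrite /height_limit [RHS]mulNr -[RHS]mulrN opprB.
Qed.

Lemma cvg_height_of_cvg_expr (h : nat -> nat) (E : R) : 0 < E ->
  (1 - beta / n%:R) ^+ h n @[n --> \oo] --> E ->
  (h n)%:R / n%:R @[n --> \oo] --> - beta^-1 * ln E.
Proof.
move=> E0 hE.
have cv : (n%:R * ln (1 - beta / n%:R))^-1 *
    ln ((1 - beta / n%:R) ^+ h n) @[n --> \oo] --> - beta^-1 * ln E.
  apply: cvgM; last by apply: continuous_cvg => //; exact: continuous_ln.
  by rewrite -invrN; apply: cvgV; [rewrite oppr_eq0 gt_eqF|exact: cvg_nln].
apply: cvg_trans cv; apply: near_eq_cvg; near=> n.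
have bn : beta < n%:R by near: n.
have qn := parameter_itv bn; have /andP[q0 q1] := qn.
have n0 : 0 < n%:R :> R := lt_trans beta_gt0 bn.
have := ln_lt0 qn; rewrite lnXn // -mulr_natr; set l := ln _ => l0.
by field; rewrite (lt_eqF l0) (gt_eqF n0).
Unshelve. all: by end_near. Qed.

(** The tail bound at l = delta * N, for which l * (1 - q) = delta * beta. *)
Lemma mallows_height_tail (d : measure_display) (T : measurableType d)
    (P : probability T R) (N L K : nat) (X : T -> 'S_N) (delta eps : R) :
  beta < N%:R -> mallows_distributed P (1 - beta / N%:R) X ->
  (L <= N)%N -> (K <= N)%N -> 0 <= delta -> delta * beta <= 2^-1 ->
  let q := 1 - beta / N%:R in
  let A := [set w : 'S_N |
    (eps <= `|q ^+ height w L K - height_mean q N L K|)%R]%SET in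
  measurable [set t | X t \in A] /\
  (P [set t | X t \in A] <=
    (2 * expR (- (delta * (eps - 2 * delta * beta ^+ 2))) ^+ N)%:E)%E.
Proof.
move=> bN XP LN KN d0 db q0 A; have [mA ->] := XP A; split => //.
have /andP[q_gt0 q_lt1] := parameter_itv bN.
have N0 : 0 < N%:R :> R := lt_trans beta_gt0 bN.
have qN : N%:R * (1 - (1 - beta / N%:R)) = beta by field; rewrite gt_eqF.
rewrite lee_fin.
apply: le_trans (height_tail q_gt0 q_lt1 (l := delta * N%:R) eps LN KN _ _) _.
- by rewrite mulr_ge0 // ltW.
- by rewrite -mulrA qN.
rewrite -mulrA qN -expRM_natl ler_wpM2l // ler_expR le_eqVlt; apply/orP; left.
by apply/eqP; ring.
Qed.

End scaling.

(** * Almost sure convergence *)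

Lemma mallows_height_ae_close (R : realType) (d : measure_display)
    (T : measurableType d) (P : probability T R) (beta x y eps : R)
    (omega : forall N : nat, T -> 'S_N) :
  0 < beta -> 0 < x < 1 -> 0 < y < 1 -> 0 < eps ->
  (forall N : nat, beta < N%:R ->
     mallows_distributed P (1 - beta / N%:R) (omega N)) ->
  {ae P, forall t, \forall N \near \oo,
    let q := 1 - beta / N%:R in
    let L := Num.truncn (x * N%:R) in
    let K := Num.truncn (y * N%:R) in
    `|q ^+ height (omega N t) L K - height_mean q N L K| < eps}.
Proof.
move=> beta_gt0 /andP[x0 x1] /andP[y0 y1] eps_gt0 omegaP.
pose q N : R := 1 - beta / N%:R.
pose L N := Num.truncn (x * N%:R).
pose K N := Num.truncn (y * N%:R).
pose A N := [set w : 'S_N |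
  (eps <= `|q N ^+ height w (L N) (K N)
            - height_mean (q N) N (L N) (K N)|)%R]%SET.
(* The parameter is only meaningful for N > beta, so the finitely many other
   events are replaced by the empty one. *)
pose F N := if beta < N%:R then [set t | omega N t \in A N] else set0.
have trunc_le (z : R) (N : nat) : 0 < z < 1 -> (Num.truncn (z * N%:R) <= N)%N.
  move=> /andP[z0 z1]; have zN : 0 <= z * N%:R by rewrite mulr_ge0 // ltW.
  have /andP[le_z _] := truncn_itv zN.
  by rewrite -(ler_nat R) (le_trans le_z) // ler_piMl // ltW.
(* Small enough for l * (1 - q) <= 1/2, and for the linear term of the exponent
   to dominate the quadratic one. *)
pose delta := Num.min (2 * beta)^-1 (eps / (4 * beta ^+ 2)).
have delta_gt0 : 0 < delta.
  by rewrite lt_min invr_gt0 divr_gt0 ?mulr_gt0 ?exprn_gt0.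
have delta_beta : delta * beta <= 2^-1.
  apply: (@le_trans _ _ ((2 * beta)^-1 * beta)).
    by rewrite ler_wpM2r ?(ltW beta_gt0) // ge_min lexx.
  by rewrite invfM divfK // gt_eqF.
have gap : 0 < eps - 2 * delta * beta ^+ 2.
  have : delta * (4 * beta ^+ 2) <= eps.
    by rewrite -ler_pdivlMr ?mulr_gt0 ?exprn_gt0 // ge_min lexx orbT.
  lra.
have FP N : measurable (F N) /\
    (P (F N) <=
      (2 * expR (- (delta * (eps - 2 * delta * beta ^+ 2))) ^+ N)%:E)%E.
  rewrite /F; case: ifPn => [bN|_].
    have LN : (L N <= N)%N by apply: trunc_le; rewrite x0.
    have KN : (K N <= N)%N by apply: trunc_le; rewrite y0.
    exact: (mallows_height_tail beta_gt0 eps bN (omegaP N bN) LN KN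
      (ltW delta_gt0) delta_beta).
  by split => //; rewrite measure0 lee_fin mulr_ge0 // exprn_ge0 ?expR_ge0.
have r01 : 0 <= expR (- (delta * (eps - 2 * delta * beta ^+ 2))) < 1.
  by rewrite expR_ge0 expR_lt1 oppr_lt0 mulr_gt0.
have := @borel_cantelli_geometric d T R P F 2 _ (fun N => (FP N).1)
  (ler0n R 2) r01 (fun N => (FP N).2).
apply: filterS => t ev; near=> N => /=.
rewrite ltNge; apply/negP => far.
have : ~ F N t by near: N.
have bN : beta < N%:R by near: N; exact: nbhs_infty_gtr.
by apply; rewrite /F bN /= inE.
Unshelve. all: by end_near. Qed.

Theorem corollary4p7 (R : realType) (d : measure_display)
  (T : measurableType d) (P : probability T R) (beta x y : R)
  (beta_gt0 : 0 < beta) (x01 : 0 < x < 1) (y01 : 0 < y < 1)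
  (omega : forall N : nat, T -> 'S_N)
  (omegaP : forall N : nat, beta < N%:R ->
     mallows_distributed P (1 - beta / N%:R) (omega N)) :
  {ae P, forall t,
    (fun N : nat =>
       (height (omega N t) (Num.truncn (x * N%:R)) (Num.truncn (y * N%:R)))%:R
       / N%:R) @ \oo --> height_limit beta x y}.
Proof.
have x0 : 0 <= x by case/andP: x01 => /ltW.
have y0 : 0 <= y by case/andP: y01 => /ltW.
have close : {ae P, forall t, forall k : nat, \forall N \near \oo,
    let q := 1 - beta / N%:R in
    let L := Num.truncn (x * N%:R) in
    let K := Num.truncn (y * N%:R) in
    `|q ^+ height (omega N t) L K - height_mean q N L K| < k.+1%:R^-1}.
  by apply: ae_foralln => k; apply: mallows_height_ae_close; rewrite ?invr_gt0.
apply: filterS close => t close; rewrite height_limitE //.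
apply: cvg_height_of_cvg_expr; rewrite ?limit_mean_gt0 //.
pose m N := height_mean (1 - beta / N%:R) N (Num.truncn (x * N%:R))
  (Num.truncn (y * N%:R)).
pose u N := (1 - beta / N%:R) ^+
  height (omega N t) (Num.truncn (x * N%:R)) (Num.truncn (y * N%:R)).
have uE : (fun N => (u N - m N) + m N) = u by apply/funext => N; rewrite subrK.
rewrite -/u -uE -[limit_mean _ _ _]add0r.
apply: cvgD; last exact: cvg_height_mean.
apply/cvgr0Pnorm_lt => e e0.
near (\oo : set_system nat) => k.
have ke : k.+1%:R^-1 < e.
  rewrite -[e]invrK ltf_pV2 ?posrE ?invr_gt0 // -natr1 ltr_wpDr //.
  by near: k; exact: nbhs_infty_gtr.
by apply: filterS (close k) => N /lt_trans; apply.
Unshelve. all: by end_near. Qed.
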